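(* Let $(\mathcal{G},S_m)$ be a graph of groups on the star graph $S_m$ whose vertex groups are free abelian groups of finite rank and whose edge groups are cyclic. For each edge $e_i$, $i=1,\dots,m$, let $k_i$ be a generator of the edge group $G_{e_i}$, and let $\alpha_{e_i}$ and $\omega_{e_i}$ be the monomorphisms of $G_{e_i}$ into the central vertex group and the corresponding external vertex group respectively. Assume that $\omega_{e_i}(k_i)$ is primitive in the external vertex group for all $i=1,\dots,m$. Then the fundamental group $G=\pi_1(\mathcal{G},S_m)$ is $\mathbb{Z}$-linear.
   Context: The star graph $S_m$ is the tree with one central vertex joined by edges $e_1,\dots,e_m$ to $m$ external vertices (leaves); each $e_i$ is oriented from the central vertex to the leaf. If $K_0$ is the central vertex group and $K_1,\dots,K_m$ are the external vertex groups, $\pi_1(\mathcal{G},S_m)$ is the quotient of the free product $K_0*K_1*\cdots*K_m$ by the relations $\alpha_{e_i}(g)=\omega_{e_i}(g)$ for $g\in G_{e_i}$, $i=1,\dots,m$. A word $w$ (element) of a free abelian group of finite rank is primitive if it can be extended to a free generating set (a basis) of the group. A group is $\mathbb{Z}$-linear if it admits a faithful representation into $GL_n(\mathbb{Z})$ for some $n$. *)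

(* Defs.v *)
From HB Require Import structures.
From mathcomp Require Import all_boot all_order all_algebra.
From mathcomp Require Import boolp.

Set Implicit Arguments.
Unset Strict Implicit.
Unset Printing Implicit Defensive.

Local Open Scope group_scope.
Local Open Scope quotient_scope.

(* Finite words over the disjoint union of the K i, modulo the congruence      *)
(* generated by deleting a letter 1 and by multiplying two adjacent letters    *)
(* that come from the same factor.                                             *)
Section FreeProduct.

Variables (I : choiceType) (K : I -> groupType).

Definition fp_letter : choiceType := {i : I & K i}.
Definition fp_word : choiceType := seq fp_letter.
Definition fp_let (i : I) (x : K i) : fp_letter := Tagged K x.

Inductive fp_eqv : fp_word -> fp_word -> Prop :=
| fp_refl u : fp_eqv u u
| fp_sym u v : fp_eqv u v -> fp_eqv v u
| fp_trans u v w : fp_eqv u v -> fp_eqv v w -> fp_eqv u w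
| fp_one u v (i : I) : fp_eqv (u ++ fp_let (1 : K i) :: v) (u ++ v)
| fp_mul u v (i : I) (x y : K i) :
    fp_eqv (u ++ fp_let x :: fp_let y :: v) (u ++ fp_let (x * y) :: v).

Definition fp_rel : rel fp_word := fun u v => `[< fp_eqv u v >].

Lemma fp_rel_refl : reflexive fp_rel.
Proof. by move=> u; apply/asboolP; exact: fp_refl. Qed.

Lemma fp_rel_sym : symmetric fp_rel.
Proof. by move=> u v; apply/asboolP/asboolP; exact: fp_sym. Qed.

Lemma fp_rel_trans : transitive fp_rel.
Proof.
move=> v u w /asboolP uv /asboolP vw; apply/asboolP; exact: fp_trans uv vw.
Qed.

Canonical fp_equiv_rel := EquivRel fp_rel fp_rel_refl fp_rel_sym fp_rel_trans.

Definition free_product := {eq_quot fp_rel}.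

HB.instance Definition _ := Choice.on free_product.
HB.instance Definition _ := EqQuotient.on free_product.

Lemma fp_piP (u v : fp_word) :
  \pi_free_product u = \pi_free_product v <-> fp_eqv u v.
Proof. by split => [/eqmodP/asboolP|uv]; [|apply/eqmodP/asboolP]. Qed.

Lemma fp_eqv_catr u u' v : fp_eqv u u' -> fp_eqv (u ++ v) (u' ++ v).
Proof.
elim=> {u u'}.
- by move=> u; exact: fp_refl.
- by move=> u w _; exact: fp_sym.
- by move=> u w t _ uw _ wt; exact: fp_trans uw wt.
- by move=> s t i; rewrite -!catA; exact: fp_one.
- by move=> s t i x y; rewrite -!catA; exact: fp_mul.
Qed.

Lemma fp_eqv_catl u v v' : fp_eqv v v' -> fp_eqv (u ++ v) (u ++ v').
Proof.
elim=> {v v'}.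
- by move=> v; exact: fp_refl.
- by move=> v w _; exact: fp_sym.
- by move=> v w t _ vw _ wt; exact: fp_trans vw wt.
- by move=> s t i; rewrite !catA; exact: fp_one.
- by move=> s t i x y; rewrite !catA; exact: fp_mul.
Qed.

Lemma fp_eqv_cat u u' v v' :
  fp_eqv u u' -> fp_eqv v v' -> fp_eqv (u ++ v) (u' ++ v').
Proof.
by move=> uu' vv'; apply: fp_trans (fp_eqv_catr v uu') (fp_eqv_catl u' vv').
Qed.

Definition fp_inv_word (u : fp_word) : fp_word :=
  rev [seq fp_let (tagged l)^-1 | l : fp_letter <- u].

Lemma fp_inv_word_cat u v :
  fp_inv_word (u ++ v) = fp_inv_word v ++ fp_inv_word u.
Proof. by rewrite /fp_inv_word map_cat rev_cat. Qed.

Lemma fp_inv_word_cons (l : fp_letter) u :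
  fp_inv_word (l :: u) = fp_inv_word u ++ [:: fp_let (tagged l)^-1].
Proof. by rewrite -cat1s fp_inv_word_cat. Qed.

Lemma fp_eqv_inv u v : fp_eqv u v -> fp_eqv (fp_inv_word u) (fp_inv_word v).
Proof.
elim=> {u v}.
- by move=> u; exact: fp_refl.
- by move=> u w _; exact: fp_sym.
- by move=> u w t _ uw _ wt; exact: fp_trans uw wt.
- move=> s t i; rewrite !fp_inv_word_cat fp_inv_word_cons /= -catA invg1.
  exact: fp_one.
- move=> s t i x y; rewrite !fp_inv_word_cat !fp_inv_word_cons /= -!catA invgM.
  exact: fp_mul.
Qed.

Lemma fp_eqv_invl u : fp_eqv (fp_inv_word u ++ u) [::].
Proof.
elim: u => [|[i x] u IHu]; first exact: fp_refl.
rewrite fp_inv_word_cons /= -catA /=; apply: fp_trans IHu.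
apply: fp_trans (fp_mul (fp_inv_word u) u x^-1 x) _.
by rewrite mulVg; exact: fp_one.
Qed.

Lemma fp_eqv_invr u : fp_eqv (u ++ fp_inv_word u) [::].
Proof.
elim: u => [|[i x] u IHu]; first exact: fp_refl.
rewrite fp_inv_word_cons -cat1s -catA catA -catA.
apply: (@fp_trans _ ([:: fp_let x] ++ [:: fp_let x^-1])).
  by rewrite [X in _ ++ X]catA; apply/fp_eqv_catl/(fp_eqv_catr _ IHu).
apply: fp_trans (fp_mul [::] [::] x x^-1) _.
by rewrite mulgV; exact: (fp_one [::] [::]).
Qed.

Definition fp_unit : free_product := \pi_free_product ([::] : fp_word).
Definition fp_mult (a b : free_product) : free_product :=
  \pi_free_product (repr a ++ repr b).
Definition fp_inv (a : free_product) : free_product :=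
  \pi_free_product (fp_inv_word (repr a)).

Lemma fp_repr_pi u : fp_eqv (repr (\pi_free_product u)) u.
Proof. by apply/fp_piP; exact: reprK. Qed.

Lemma fp_mult_pi u v :
  fp_mult (\pi_free_product u) (\pi_free_product v) = \pi_free_product (u ++ v).
Proof. by apply/fp_piP; apply: fp_eqv_cat; exact: fp_repr_pi. Qed.

Lemma fp_inv_pi u :
  fp_inv (\pi_free_product u) = \pi_free_product (fp_inv_word u).
Proof. by apply/fp_piP; apply: fp_eqv_inv; exact: fp_repr_pi. Qed.

Lemma fp_surj (a : free_product) : exists u, a = \pi_free_product u.
Proof. by exists (repr a); apply: esym; exact: reprK. Qed.

Lemma fp_multA : associative fp_mult.
Proof.
move=> a b c; have [u ->] := fp_surj a.
have [v ->] := fp_surj b; have [w ->] := fp_surj c.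
by rewrite !fp_mult_pi catA.
Qed.

Lemma fp_1mult : left_id fp_unit fp_mult.
Proof. by move=> a; have [u ->] := fp_surj a; rewrite fp_mult_pi. Qed.

Lemma fp_mult1 : right_id fp_unit fp_mult.
Proof. by move=> a; have [u ->] := fp_surj a; rewrite fp_mult_pi cats0. Qed.

Lemma fp_Vmult : left_inverse fp_unit fp_inv fp_mult.
Proof.
move=> a; have [u ->] := fp_surj a; rewrite fp_inv_pi fp_mult_pi.
by apply/fp_piP; exact: fp_eqv_invl.
Qed.

Lemma fp_multV : right_inverse fp_unit fp_inv fp_mult.
Proof.
move=> a; have [u ->] := fp_surj a; rewrite fp_inv_pi fp_mult_pi.
by apply/fp_piP; exact: fp_eqv_invr.
Qed.

HB.instance Definition _ :=
  isGroup.Build free_product fp_multA fp_1mult fp_mult1 fp_Vmult fp_multV.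

Definition fp_in (i : I) (x : K i) : free_product :=
  \pi_free_product ([:: fp_let x] : fp_word).

Lemma fp_in_morph (i : I) : {morph @fp_in i : x y / x * y}.
Proof.
move=> x y; apply: esym; rewrite [LHS]fp_mult_pi.
by apply/fp_piP; exact: (fp_mul [::] [::]).
Qed.

HB.instance Definition _ (i : I) :=
  isMultiplicative.Build (K i) free_product (@fp_in i) (@fp_in_morph i).

End FreeProduct.

Section QuotientByNormalClosure.

Variables (G : groupType) (S : G -> Prop).

Inductive normal_closure : G -> Prop :=
| ncl_in x : S x -> normal_closure x
| ncl_1 : normal_closure 1
| ncl_M x y : normal_closure x -> normal_closure y -> normal_closure (x * y)
| ncl_V x : normal_closure x -> normal_closure x^-1
| ncl_J x y : normal_closure x -> normal_closure (x ^ y).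

Definition ncl_rel : rel G := fun x y => `[< normal_closure (x / y) >].

Lemma ncl_rel_refl : reflexive ncl_rel.
Proof. by move=> x; apply/asboolP; rewrite mulgV; exact: ncl_1. Qed.

Lemma ncl_rel_sym : symmetric ncl_rel.
Proof.
by move=> x y; apply/asboolP/asboolP => /ncl_V; rewrite invgM invgK.
Qed.

Lemma ncl_rel_trans : transitive ncl_rel.
Proof.
move=> y x z /asboolP xy /asboolP yz; apply/asboolP.
by have := ncl_M xy yz; rewrite mulgA mulgVK.
Qed.

Canonical ncl_equiv_rel :=
  EquivRel ncl_rel ncl_rel_refl ncl_rel_sym ncl_rel_trans.

Definition ncl_quot := {eq_quot ncl_rel}.

HB.instance Definition _ := Choice.on ncl_quot.
HB.instance Definition _ := EqQuotient.on ncl_quot.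

Lemma ncl_piP (x y : G) :
  \pi_ncl_quot x = \pi_ncl_quot y <-> normal_closure (x / y).
Proof. by split => [/eqmodP/asboolP|xy]; [|apply/eqmodP/asboolP]. Qed.

Definition nq_one : ncl_quot := \pi_ncl_quot 1.
Definition nq_mul (a b : ncl_quot) : ncl_quot := \pi_ncl_quot (repr a * repr b).
Definition nq_inv (a : ncl_quot) : ncl_quot := \pi_ncl_quot (repr a)^-1.

Lemma nq_repr_pi x : normal_closure (repr (\pi_ncl_quot x) / x).
Proof. by apply/ncl_piP; exact: reprK. Qed.

Lemma nq_mul_pi x y :
  nq_mul (\pi_ncl_quot x) (\pi_ncl_quot y) = \pi_ncl_quot (x * y).
Proof.
apply/ncl_piP; rewrite invgM.
set x' := repr (\pi_ncl_quot x); set y' := repr (\pi_ncl_quot y).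
have -> : x' * y' * (y^-1 * x^-1) = x' / x * (y' / y) ^ x^-1.
  by rewrite conjgE invgK !mulgA mulgVK.
by apply: ncl_M; [|apply: ncl_J]; exact: nq_repr_pi.
Qed.

Lemma nq_inv_pi x : nq_inv (\pi_ncl_quot x) = \pi_ncl_quot x^-1.
Proof.
apply/ncl_piP; rewrite invgK; set x' := repr (\pi_ncl_quot x).
have -> : x'^-1 * x = (x' / x)^-1 ^ x'.
  by rewrite invgM invgK conjgE mulgVK.
by apply/ncl_J/ncl_V/nq_repr_pi.
Qed.

Lemma nq_surj (a : ncl_quot) : exists x, a = \pi_ncl_quot x.
Proof. by exists (repr a); apply: esym; exact: reprK. Qed.

Lemma nq_mulA : associative nq_mul.
Proof.
move=> a b c; have [u ->] := nq_surj a.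
have [v ->] := nq_surj b; have [w ->] := nq_surj c.
by rewrite !nq_mul_pi mulgA.
Qed.

Lemma nq_1mul : left_id nq_one nq_mul.
Proof. by move=> a; have [u ->] := nq_surj a; rewrite nq_mul_pi mul1g. Qed.

Lemma nq_mul1 : right_id nq_one nq_mul.
Proof. by move=> a; have [u ->] := nq_surj a; rewrite nq_mul_pi mulg1. Qed.

Lemma nq_Vmul : left_inverse nq_one nq_inv nq_mul.
Proof.
by move=> a; have [u ->] := nq_surj a; rewrite nq_inv_pi nq_mul_pi mulVg.
Qed.

Lemma nq_mulV : right_inverse nq_one nq_inv nq_mul.
Proof.
by move=> a; have [u ->] := nq_surj a; rewrite nq_inv_pi nq_mul_pi mulgV.
Qed.

HB.instance Definition _ :=
  isGroup.Build ncl_quot nq_mulA nq_1mul nq_mul1 nq_Vmul nq_mulV.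

End QuotientByNormalClosure.

(* The vertices of S_m are indexed by option 'I_m: None is the central vertex  *)
(* and Some i is the leaf of the i-th edge.                                    *)
Record star_graph_of_groups (m : nat) := StarGraphOfGroups {
  vertex_group : option 'I_m -> groupType;
  edge_group : 'I_m -> groupType;
  alpha : forall i, {multiplicative edge_group i -> vertex_group None};
  omega : forall i, {multiplicative edge_group i -> vertex_group (Some i)};
  alpha_inj : forall i, injective (alpha i);
  omega_inj : forall i, injective (omega i)
}.

Definition pi1_relator (m : nat) (GG : star_graph_of_groups m)
    (x : free_product (vertex_group GG)) : Prop :=
  exists (i : 'I_m) (g : edge_group GG i),
    x = fp_in (alpha GG i g) / fp_in (omega GG i g).

Definition pi1 (m : nat) (GG : star_graph_of_groups m) : groupType :=
  ncl_quot (@pi1_relator m GG).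

Definition expgz (G : groupType) (x : G) (z : int) : G :=
  match z with Posz n => x ^+ n | Negz n => x ^- n.+1 end.

Definition is_generator (G : groupType) (k : G) : Prop :=
  forall g : G, exists z : int, g = expgz k z.

Definition is_basis (A : groupType) (n : nat) (b : 'I_n -> A) : Prop :=
  (forall x y : A, x * y = y * x) /\
  forall x : A, exists! c : {ffun 'I_n -> int},
    x = \prod_(i < n) expgz (b i) (c i).

Definition free_abelian_fin_rank (A : groupType) : Prop :=
  exists (n : nat) (b : 'I_n -> A), is_basis b.

Definition is_primitive (A : groupType) (w : A) : Prop :=
  exists (n : nat) (b : 'I_n -> A), is_basis b /\ exists i : 'I_n, b i = w.

Section GeneralLinearGroup.

Variables (R : comUnitRingType) (n : nat).

Definition GL := {A : 'M[R]_n | A \in unitmx}.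

HB.instance Definition _ := SubChoice.on GL.

Definition GL_one : GL := exist (fun M => M \in unitmx) _ (unitmx1 R n).

Lemma GL_mul_subproof (A B : GL) : (val A *m val B)%R \in unitmx.
Proof. by rewrite unitmx_mul (valP A) (valP B). Qed.
Definition GL_mul (A B : GL) : GL :=
  exist (fun M => M \in unitmx) _ (GL_mul_subproof A B).

Lemma GL_inv_subproof (A : GL) : invmx (val A) \in unitmx.
Proof. by rewrite unitmx_inv (valP A). Qed.
Definition GL_inv (A : GL) : GL :=
  exist (fun M => M \in unitmx) _ (GL_inv_subproof A).

Lemma GL_mulA : associative GL_mul.
Proof. by move=> A B C; apply: val_inj; rewrite /= mulmxA. Qed.

Lemma GL_1mul : left_id GL_one GL_mul.
Proof. by move=> A; apply: val_inj; rewrite /= mul1mx. Qed.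

Lemma GL_mul1 : right_id GL_one GL_mul.
Proof. by move=> A; apply: val_inj; rewrite /= mulmx1. Qed.

Lemma GL_Vmul : left_inverse GL_one GL_inv GL_mul.
Proof. by move=> A; apply: val_inj; rewrite /= mulVmx ?(valP A). Qed.

Lemma GL_mulV : right_inverse GL_one GL_inv GL_mul.
Proof. by move=> A; apply: val_inj; rewrite /= mulmxV ?(valP A). Qed.

HB.instance Definition _ :=
  isGroup.Build GL GL_mulA GL_1mul GL_mul1 GL_Vmul GL_mulV.

End GeneralLinearGroup.

Definition Z_linear (G : groupType) : Prop :=
  exists (n : nat) (rho : {multiplicative G -> GL int n}), injective rho.

(* Main.v *)
From HB Require Import structures.
Require Import Defs.
From mathcomp Require Import all_boot all_order all_algebra.
From mathcomp Require Import boolp.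
From mathcomp Require Import ring lra zify.

(** Write K_0 for the central vertex group, K_i for the leaf groups, w_i in K_i
and alpha_i in K_0 for the two images of the generator k_i, so that the
fundamental group G is generated by the vertex groups subject to
alpha_i = w_i.  A faithful representation of G on some Z^N is built from a
commutative group of translations and one reflection per edge; faithfulness is
the argument by which a Coxeter group acts faithfully on its root system.

Since w_i belongs to a basis of K_i, all the vertex groups embed in one lattice
L = Z^D by maps iota_v that agree on every edge group: K_0 sits in the first
coordinates, w_i goes to a_i := iota(alpha_i), and the rest of a basis of K_i
goes to fresh coordinates ([common_lattice]).  Suppose L acts on an abelian
group V by t |-> rho t, and V carries, for every edge i, a linear form phi_i
and a root u_i with phi_i(u_i) = -2, both fixed by a_i.  Then
r_i v = v + phi_i(v) u_i is an involution commuting with rho(a_i), so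
that K_0 can act by rho o iota_0, and K_i by the conjugate
r_i (rho o iota_i) r_i; these rules agree on the edge groups, hence G acts
([pi1_action]).

Any element of G outside K_0 is an alternating product of elements of K_0
and of leaf elements that cannot be shortened ([pi1_normal_form]).  Assume
phi_j(rho t u_i) >= 2 unless i = j and t is a multiple of a_i, and that some
base vector has phi_j(rho t v0) = 1 throughout.  Applying such a product
to the base vector alternates translations and reflections, never with a
translation along a_i between two reflections r_i.  After every reflection
r_i the vector satisfies phi_i(v) < 0, while every form phi_j o rho t that
differs from phi_i in the above sense is at least -phi_i(v)
([chamber_refl]).  Therefore the product moves the base vector; the nontrivial
elements of K_0 do so too, because only 0 in L fixes the base vector.

It remains to find such a system with V of finite rank over Z.  The matrix
coefficient t |-> phi_i(rho t u_i) must equal -2 exactly on the multiples of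
a_i, which form a sublattice that need not be a direct factor of L.  With
P > 0 and a form lam_i taking the value P at a_i, the vector t is a multiple
of a_i if and only if mu_i(t) := P t - lam_i(t) a_i vanishes and P divides
lam_i(t) ([axis_forms]).  The function
2 + 4 |mu_i(t)|^2 - 4 [P divides lam_i(t)] has the required values, and it is a
matrix coefficient of an integral representation: the quadratic term comes from
a unipotent representation, the periodic one from a cyclic permutation of P
coordinates ([tau], [xi_tau]). *)

Set Implicit Arguments.
Unset Strict Implicit.
Unset Printing Implicit Defensive.

Import Order.TTheory GRing.Theory Num.Theory.
Import VectorInternalTheory.
Local Open Scope ring_scope.
Local Open Scope quotient_scope.

(** * Faithful integral actions and integral matrices *)

Lemma morphD_mulrz (A B : zmodType) (f : A -> B) :
  (forall v w, f (v + w) = f v + f w) ->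
  forall v (z : int), f (v *~ z) = f v *~ z.
Proof.
move=> fD v z.
have f0 : f 0 = 0 by apply: (addrI (f 0)); rewrite -fD !addr0.
have fN w : f (- w) = - f w by apply/eqP; rewrite -addr_eq0 -fD addNr f0.
have fX w n : f (w *+ n) = f w *+ n.
  by elim: n => [|n IHn]; rewrite ?mulr0n // !mulrS fD IHn.
by case: z => n; rewrite ?NegzE ?mulrNz ?fN fX.
Qed.

Section LinearActions.
Local Open Scope group_scope.
Variable V : vectType int.
Implicit Types (f : V -> V) (v w : V).

Let additive_map f := forall v w, f (v + w)%R = (f v + f w)%R.

Definition colv v : 'cV[int]_(dim V) := ((v2r v)^T)%R.
Definition map_mx_of f : 'M[int]_(dim V) := (lin1_mx (v2r \o f \o r2v))^T%R.

Lemma colv_inj : injective colv.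
Proof. by move=> v w /trmx_inj/v2r_inj. Qed.

Lemma colv_ext (A B : 'M[int]_(dim V)) :
  (forall v, A *m colv v = B *m colv v)%R -> A = B.
Proof.
move=> AB; apply: trmx_inj; apply/row_matrixP => i.
have := AB (r2v (delta_mx 0 i)%R); rewrite /colv r2vK => /(congr1 trmx).
by rewrite !trmx_mul trmxK !rowE.
Qed.

Lemma map_mx_ofE f v : additive_map f -> (map_mx_of f *m colv v)%R = colv (f v).
Proof.
move=> fD; have fL : linear (v2r \o f \o r2v).
  have fZ (z : int) w : f (z *: w)%R = (z *: f w)%R.
    by rewrite -[z]intz !scaler_int morphD_mulrz.
  by move=> a r s /=; rewrite linearP fD fZ linearP.
pose F : {linear 'rV[int]_(dim V) -> 'rV[int]_(dim V)} :=
  HB.pack (v2r \o f \o r2v) (GRing.isLinear.Build _ _ _ _ _ fL).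
rewrite /colv /map_mx_of -trmx_mul; congr (_^T)%R.
by rewrite (mul_rV_lin1 F) /= v2rK.
Qed.

(** Representing the automorphism v |-> act g v by a matrix on column vectors
makes g |-> matrix multiplicative; its invertibility comes from g^-1. *)
Lemma Z_linear_of_action (G : groupType) (act : G -> V -> V) :
    (forall g, additive_map (act g)) ->
    (forall v, act 1 v = v) ->
    (forall g h v, act (g * h) v = act g (act h v)) ->
    (forall g, (forall v, act g v = v) -> g = 1) ->
  Z_linear G.
Proof.
move=> actD act1 actM act_faithful.
have M1 : map_mx_of (act 1) = 1%:M%R.
  by apply: colv_ext => v; rewrite map_mx_ofE // act1 mul1mx.
have MM g h :
    map_mx_of (act (g * h)) = (map_mx_of (act g) *m map_mx_of (act h))%R.
  by apply: colv_ext => v; rewrite -mulmxA !map_mx_ofE // actM.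
have MU g : map_mx_of (act g) \in unitmx.
  have gV : (map_mx_of (act g) *m map_mx_of (act g^-1%g) = 1%:M)%R.
    by rewrite -MM mulgV.
  by have [] := mulmx1_unit gV.
pose rho g : GL int (dim V) := exist (fun A => A \in unitmx) _ (MU g).
have rhoM : {morph rho : g h / g * h} by move=> g h; apply: val_inj; apply: MM.
pose Rho : {multiplicative G -> GL int (dim V)} :=
  HB.pack rho (isMultiplicative.Build _ _ rho rhoM).
exists (dim V), Rho => g h /(congr1 val) /= gh.
apply/eqP; rewrite -divg_eq1; apply/eqP; apply: act_faithful => v.
have ghE w : act g w = act h w.
  by apply: colv_inj; rewrite -!map_mx_ofE // gh.
by rewrite actM ghE -actM mulgV act1.
Qed.

End LinearActions.

(** * Coordinates in free abelian groups *)

Section IntegerPowers.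
Local Open Scope group_scope.
Variable G : groupType.
Implicit Type x : G.

Lemma expgzS x (z : int) : expgz x (z + 1)%R = expgz x z * x.
Proof.
case: z => n.
  have -> : (n%:Z + 1 = n.+1)%R by lia.
  by rewrite /= expgSr.
case: n => [|n]; first by rewrite /= expg1 mulVg.
have -> : (Negz n.+1 + 1 = Negz n)%R by rewrite !NegzE; lia.
by rewrite /= [x ^+ n.+2]expgS invgM mulgVK.
Qed.

Lemma expgzD x (y z : int) : expgz x (y + z)%R = expgz x y * expgz x z.
Proof.
have nat_case n t : expgz x (t + Posz n)%R = expgz x t * x ^+ n.
  elim: n => [|n IHn]; first by rewrite GRing.addr0 mulg1.
  by rewrite intS [(1 + _)%R]GRing.addrC GRing.addrA expgzS IHn expgSr mulgA.
case: z => n; first exact: nat_case.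
by rewrite -[in RHS](GRing.subrK (Posz n.+1) y) nat_case /= NegzE mulgK.
Qed.

Lemma additive_morph1 (A : zmodType) (h : G -> A) :
  (forall x y, h (x * y)%g = h x + h y)%R -> h 1 = 0%R.
Proof. by move=> hM; apply: (GRing.addrI (h 1)); rewrite -hM mulg1 GRing.addr0. Qed.

Lemma additive_expgz (A : zmodType) (h : G -> A) x (z : int) :
  (forall x y, h (x * y)%g = h x + h y)%R -> h (expgz x z) = (h x *~ z)%R.
Proof.
move=> hM; have h1 := additive_morph1 hM.
have hX n : h (x ^+ n) = (h x *+ n)%R.
  by elim: n => [|n IHn]; rewrite ?h1 // expgS hM IHn GRing.mulrS.
have hV y : h y^-1 = (- h y)%R.
  by apply/eqP; rewrite -GRing.addr_eq0 -hM mulVg h1.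
by case: z => n /=; rewrite ?hV hX // NegzE mulrNz.
Qed.

End IntegerPowers.

Lemma multiplicative1 (G H : groupType) (h : {multiplicative G -> H}) :
  h 1%g = 1%g.
Proof. by apply: (mulgI (h 1%g)); rewrite -gmulfM !mulg1. Qed.

Section BasisCoordinates.
Local Open Scope group_scope.
Variables (A : groupType) (n : nat) (b : 'I_n -> A).
Hypothesis bP : is_basis b.

Definition coord (x : A) : {ffun 'I_n -> int} := sval (cid (proj2 bP x)).

Lemma coordK x : x = \prod_(i < n) expgz (b i) (coord x i).
Proof. by rewrite /coord; case: cid => c /= []. Qed.

Lemma coord_unique x (c : {ffun 'I_n -> int}) :
  x = \prod_(i < n) expgz (b i) (c i) -> coord x = c.
Proof. by rewrite /coord; case: cid => d /= [_ dU]; apply: dU. Qed.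

Lemma coordM x y : coord (x * y) = (coord x + coord y)%R.
Proof.
apply: coord_unique; rewrite {1}(coordK x) {1}(coordK y).
rewrite -prodgM_commute; last by move=> i j _ _; have [comm _] := bP; exact: comm.
by apply: eq_bigr => i _; rewrite ffunE expgzD.
Qed.

Lemma coord_inj : injective coord.
Proof. by move=> x y xy; rewrite (coordK x) (coordK y) xy. Qed.

Lemma coord_basis i : coord (b i) = [ffun j => (j == i)%:Z%R].
Proof.
apply: coord_unique; rewrite -[LHS](big_pred1_eq *%g) big_mkcond /=.
by apply: eq_bigr => j _; rewrite ffunE; case: eqP => [->|_] //=; rewrite expg1.
Qed.

End BasisCoordinates.

(** The coordinate of w itself is kept apart as e.  The remaining ones are
stored in a row of any sufficient length d, padded by zeros, so that a single
length can later serve all the leaf groups. *)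
Lemma primitive_coords (A : groupType) (w : A) : is_primitive w ->
  exists n : nat, forall d : nat, (n <= d)%N ->
  exists (e : A -> int) (f : A -> 'rV[int]_d),
    [/\ forall x y, e (x * y)%g = (e x + e y)%R,
        forall x y, f (x * y)%g = (f x + f y)%R,
        forall x y, e x = e y -> f x = f y -> x = y,
        e w = 1%R & f w = 0%R].
Proof.
case=> n [b [bP [i0 <-]]]; exists n => d le_nd.
pose f x : 'rV[int]_d :=
  (\row_j (if insub (val j) is Some k then coord bP x k *+ (k != i0) else 0))%R.
exists (coord bP ^~ i0), f; split=> [x y|x y|x y exy fxy||].
- by rewrite coordM ffunE.
- apply/rowP => j; rewrite !mxE; case: insubP => [k _ _|_].
    by rewrite coordM ffunE GRing.mulrnDl.
  by rewrite GRing.addr0.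
- apply: (coord_inj (bP := bP)); apply/ffunP => k.
  have [->|nk] := eqVneq k i0; first exact: exy.
  have := congr1 (fun r : 'rV_d => r ord0 (widen_ord le_nd k)) fxy.
  by rewrite !mxE /= valK nk.
- by rewrite coord_basis ffunE eqxx.
- apply/rowP => j; rewrite !mxE; case: insubP => [k _ _|//].
  by rewrite coord_basis ffunE; case: eqP.
Qed.

Lemma free_abelian_coords (A : groupType) : free_abelian_fin_rank A ->
  exists (n : nat) (c : A -> 'rV[int]_n),
    (forall x y, c (x * y)%g = (c x + c y)%R) /\ injective c.
Proof.
case=> n [b bP]; exists n, (fun x => \row_j coord bP x j)%R; split=> x y.
  by apply/rowP => j; rewrite !mxE coordM ffunE.
move=> /rowP xy; apply: (coord_inj (bP := bP)); apply/ffunP => k.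
by have := xy k; rewrite !mxE.
Qed.

(** * Actions and normal forms of the fundamental group *)

Section FundamentalGroup.
Local Open Scope group_scope.
Variables (m : nat) (GG : star_graph_of_groups m).
Local Notation K := (vertex_group GG).

Definition pi1_in (v : option 'I_m) (x : K v) : pi1 GG :=
  \pi_(ncl_quot (@pi1_relator m GG)) (fp_in x).

Lemma pi1_inM v : {morph @pi1_in v : x y / x * y}.
Proof.
by move=> x y; rewrite /pi1_in gmulfM; apply: esym; exact: nq_mul_pi.
Qed.

Lemma pi1_in1 v : pi1_in (1 : K v) = 1.
Proof. by apply: (mulgI (pi1_in (1 : K v))); rewrite -pi1_inM !mulg1. Qed.

Lemma pi1_in_edge i (g : edge_group GG i) :
  pi1_in (alpha GG i g) = pi1_in (omega GG i g).
Proof. by apply/ncl_piP; apply: ncl_in; exists i, g. Qed.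

Lemma pi1_ind (P : pi1 GG -> Prop) :
  P 1 -> (forall v (x : K v) g, P g -> P (pi1_in x * g)) -> forall g, P g.
Proof.
move=> P1 PM g; have [a ->] := nq_surj g; have [u ->] := fp_surj a.
elim: u => [|[v x] u IHu]; first exact: P1.
rewrite -cat1s -fp_mult_pi -nq_mul_pi; exact: PM.
Qed.

(** The universal property of the fundamental group, for actions on a set:
letters act through F, and the relators act trivially by agreement on edges. *)
Lemma pi1_action (V : Type) (F : forall v, K v -> V -> V) :
    (forall v p, F v 1 p = p) ->
    (forall v x y p, F v (x * y) p = F v x (F v y p)) ->
    (forall i (g : edge_group GG i) p,
       F None (alpha GG i g) p = F (Some i) (omega GG i g) p) ->
  exists act : pi1 GG -> V -> V,
    [/\ forall p, act 1 p = p,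
        forall g h p, act (g * h) p = act g (act h p)
      & forall v (x : K v) p, act (pi1_in x) p = F v x p].
Proof.
move=> F1 FM Fedge.
pose actw (u : fp_word K) p :=
  foldr (fun l : fp_letter K => F (tag l) (tagged l)) p u.
have actw_cat u w p : actw (u ++ w) p = actw u (actw w p) by exact: foldr_cat.
have actw_eqv u w : fp_eqv u w -> forall p, actw u p = actw w p.
  elim=> {u w} [//|u w _ uw p|u w t _ uw _ wt p|u w v p|u w v x y p] //.
  - by rewrite uw wt.
  - by rewrite !actw_cat /= F1.
  - by rewrite !actw_cat /= FM.
pose actf (a : free_product K) := actw (repr a).
have actf_pi u p : actf (\pi_(free_product K) u) p = actw u p.
  by apply: actw_eqv; exact: fp_repr_pi.
have actfM a b p : actf (a * b) p = actf a (actf b p).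
  have [u ->] := fp_surj a; have [w ->] := fp_surj b.
  by rewrite [_ * _]fp_mult_pi !actf_pi actw_cat.
have actf1 p : actf 1 p = p by rewrite actf_pi.
have actf_in v (x : K v) p : actf (fp_in x) p = F v x p by rewrite actf_pi.
have actf_ncl a : normal_closure (@pi1_relator m GG) a -> forall p, actf a p = p.
  have actfV b : (forall p, actf b p = p) -> forall p, actf b^-1 p = p.
    by move=> bE p; rewrite -{1}(bE p) -actfM mulVg actf1.
  elim=> {a} [a [i [g ->]] p|//|a b _ aE _ bE p|a _|a b _ aE p].
  - rewrite actfM actf_in Fedge -actf_in -actfM mulgV; exact: actf1.
  - by rewrite actfM bE aE.
  - exact: actfV.
  - by rewrite conjgE !actfM aE -actfM mulVg actf1.
pose act (g : pi1 GG) := actf (repr g).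
have act_pi a p : act (\pi_(pi1 GG) a) p = actf a p.
  have /actf_ncl aE := nq_repr_pi (@pi1_relator m GG) a.
  by rewrite /act -[in LHS](mulgVK a (repr _)) actfM aE.
exists act; split=> [p|g h p|v x p]; last by rewrite act_pi actf_in.
  by rewrite act_pi actf1.
have [a ->] := nq_surj g; have [b ->] := nq_surj h.
by rewrite [_ * _]nq_mul_pi !act_pi actfM.
Qed.

Definition leaf_edge i (y : K (Some i)) := exists g, y = omega GG i g.
Definition centre_edge i (x : K None) := exists g, x = alpha GG i g.

(** Alternating products y x y' x' ... starting in the leaf group i, with leaf
letters outside the edge groups.  Two consecutive leaf letters of the same edge
are separated by a central letter outside this edge group: otherwise the three
letters would merge into one. *)
Inductive reduced : 'I_m -> pi1 GG -> Prop :=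
| reduced_last i (y : K (Some i)) (x : K None) :
    ~ leaf_edge y -> reduced i (pi1_in y * pi1_in x)
| reduced_cons i (y : K (Some i)) (x : K None) j h :
    ~ leaf_edge y -> ~ (i = j /\ centre_edge j x) -> reduced j h ->
    reduced i (pi1_in y * (pi1_in x * h)).

Definition normal_form (g : pi1 GG) : Prop :=
  (exists x : K None, g = pi1_in x) \/
  exists (x : K None) j h, reduced j h /\ g = pi1_in x * h.

Lemma normal_form_centre (x : K None) g : normal_form g -> normal_form (pi1_in x * g).
Proof.
case=> [[x' ->]|[x' [j [h [hr ->]]]]].
  by left; exists (x * x'); rewrite pi1_inM.
by right; exists (x * x'), j, h; rewrite pi1_inM mulgA.
Qed.

Lemma normal_form_edge i (y : K (Some i)) g :
  leaf_edge y -> normal_form g -> normal_form (pi1_in y * g).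
Proof. by case=> e ->; rewrite -pi1_in_edge; exact: normal_form_centre. Qed.

(** A leaf letter y in the edge group counts as a central one.  Otherwise it can
be put in front of a normal form, except when the first leaf letter y' comes from
the same edge and the central letter before it lies in the edge group; then the
three combine into one leaf letter, which may in turn fall into the edge
group. *)
Lemma normal_form_leaf i (y : K (Some i)) g :
  normal_form g -> normal_form (pi1_in y * g).
Proof.
have reducedW (h : pi1 GG) : reduced i h -> normal_form h.
  by move=> hr; right; exists 1, i, h; rewrite pi1_in1 mul1g.
move=> gN; have [ye|yn] := EM (leaf_edge y); first exact: normal_form_edge.
case: gN => [[x ->]|[x [j [h [hr ->]]]]]; first exact/reducedW/reduced_last.
have [[ij [e xE]]|jx] := EM (i = j /\ centre_edge j x); last first.
  exact/reducedW/(reduced_cons yn jx hr).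
subst j; rewrite xE pi1_in_edge {x xE}.
case: i h / hr y e yn reducedW => [i y' x _|i y' x j' h _ jx hr] y e yn reducedW.
  rewrite !mulgA -!pi1_inM.
  have [ye|yn'] := EM (leaf_edge (y * omega GG i e * y')).
    by apply: normal_form_edge => //; left; exists x.
  exact/reducedW/reduced_last.
rewrite !mulgA -!pi1_inM -mulgA.
have [ye|yn'] := EM (leaf_edge (y * omega GG i e * y')).
  by apply: normal_form_edge => //; right; exists x, j', h.
exact/reducedW/(reduced_cons yn' jx hr).
Qed.

Lemma pi1_normal_form g : normal_form g.
Proof.
elim/pi1_ind: g => [|[i|] x g gN].
- by left; exists 1; rewrite pi1_in1.
- exact: normal_form_leaf.
- exact: normal_form_centre.
Qed.

End FundamentalGroup.

(** * Reflection systems and their faithful actions *)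

Definition axis (m : nat) (L : zmodType) (a : 'I_m -> L) i t :=
  exists z : int, t = a i *~ z.

(** Abstracts the geometric representation of a Coxeter group.  The roots are
the translates of the vectors root i, one for each class of translations modulo
a_i, and phi i stands for -2 times the pairing with root i.  It is -2 on root i
itself and at least 2 on all other roots, as for reflections any two of which
generate an infinite dihedral group. *)
Record reflection_system (m : nat) (L V : zmodType) (a : 'I_m -> L) :=
    ReflectionSystem {
  rho : L -> V -> V;
  phi : 'I_m -> V -> int;
  root : 'I_m -> V;
  base : V;
  rho0 : forall v, rho 0 v = v;
  rhoD : forall s t v, rho (s + t) v = rho s (rho t v);
  rho_add : forall t v w, rho t (v + w) = rho t v + rho t w;
  phi_add : forall i v w, phi i (v + w) = phi i v + phi i w;
  phi_axis : forall i t v, axis a i t -> phi i (rho t v) = phi i v;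
  root_axis : forall i t, axis a i t -> rho t (root i) = root i;
  phi_root_self : forall i, phi i (root i) = - 2;
  phi_root_off :
    forall i j t, ~ (j = i /\ axis a i t) -> 2 <= phi j (rho t (root i));
  phi_base : forall j t, phi j (rho t base) = 1;
  rho_base : forall t, rho t base = base -> t = 0
}.

Section PingPong.
Variables (m : nat) (L V : zmodType) (a : 'I_m -> L).
Variable S : reflection_system V a.
Local Notation rho := (rho S).
Local Notation phi := (phi S).

Definition refl i v := v + root S i *~ phi i v.

Lemma phi_refl j t i v :
  phi j (rho t (refl i v)) = phi j (rho t v) + phi j (rho t (root S i)) * phi i v.
Proof.
rewrite /refl rho_add phi_add (morphD_mulrz (rho_add S t)).
by rewrite (morphD_mulrz (phi_add S j)) mulrzz.
Qed.

Lemma phi_refl0 i v : phi i (refl i v) = - phi i v.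
Proof. by rewrite -[in LHS](rho0 S (refl i v)) phi_refl !rho0 phi_root_self; lia. Qed.

Lemma reflK i : involutive (refl i).
Proof. by move=> v; rewrite {1}/refl phi_refl0 mulrNz addrK. Qed.

Lemma refl_add i v w : refl i (v + w) = refl i v + refl i w.
Proof. by rewrite /refl phi_add mulrzDr addrACA. Qed.

Lemma refl_axis i t v : axis a i t -> refl i (rho t (refl i v)) = rho t v.
Proof.
move=> ti; have reflC w : refl i (rho t w) = rho t (refl i w).
  by rewrite /refl phi_axis // rho_add (morphD_mulrz (rho_add S t)) root_axis.
by rewrite -reflC reflK.
Qed.

Definition pos_cone v := forall j t, 0 < phi j (rho t v).

(** The vectors just reflected by r_i out of the positive cone: among all forms
only phi_i, up to translation along a_i, is negative, and the others dominate
it.  The domination is what makes the property survive further reflections. *)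
Definition chamber i v :=
  phi i v < 0 /\ forall j t, ~ (j = i /\ axis a i t) -> - phi i v <= phi j (rho t v).

Lemma pos_cone_rho t v : pos_cone v -> pos_cone (rho t v).
Proof. by move=> vP j s; rewrite -rhoD. Qed.

Lemma pos_cone_refl i v : pos_cone v -> chamber i (refl i v).
Proof.
move=> vP; have := vP i 0; rewrite rho0 => vi.
split=> [|j t jt]; first by rewrite phi_refl0 oppr_lt0.
rewrite phi_refl0 opprK phi_refl.
have vj := vP j t; have fj := phi_root_off S jt.
by nia.
Qed.

(** Put c' = phi_j(rho t v), so c' >= c = -phi_i(v) > 0.  After reflection a form
phi_k o rho s becomes at least -c + 2 c' >= c', where -c bounds the only form
that can be negative on v and 2 comes from the pairing of distinct roots. *)
Lemma chamber_refl i j t v :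
  chamber i v -> ~ (j = i /\ axis a i t) -> chamber j (refl j (rho t v)).
Proof.
move=> [vi vch] jt; have c_ge := vch j t jt.
split=> [|k s ks]; first by rewrite phi_refl0; lia.
rewrite phi_refl0 opprK phi_refl -rhoD.
have fk := phi_root_off S ks.
suff A_ge : phi i v <= phi k (rho (s + t) v).
  have c_gt0 : 0 < phi j (rho t v) by lra.
  by have := ler_wpM2r (ltW c_gt0) fk; lra.
have [[-> st]|/vch] := EM (k = i /\ axis a i (s + t)); last by lia.
by rewrite phi_axis.
Qed.

End PingPong.

Section FaithfulAction.
Variables (m : nat) (GG : star_graph_of_groups m) (L V : zmodType).
Variables (iota : forall v, vertex_group GG v -> L) (a : 'I_m -> L).
Variable S : reflection_system V a.

Hypothesis iotaM :
  forall v (x y : vertex_group GG v), iota (x * y)%g = iota x + iota y.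
Hypothesis iota_inj : forall v, injective (@iota v).
Hypothesis iota_edge :
  forall i (g : edge_group GG i), iota (alpha GG i g) = iota (omega GG i g).
Hypothesis axis_edge :
  forall i t, axis a i t <-> exists g, t = iota (alpha GG i g).

(** The conjugation by the reflection r_i keeps the leaf group i in general
position with respect to K_0, while fixing the translations along a_i. *)
Definition gen_action v (x : vertex_group GG v) : V -> V :=
  if v is Some i then refl S i \o rho S (iota x) \o refl S i
  else rho S (iota x).

Lemma leaf_off_axis i (y : vertex_group GG (Some i)) :
  ~ leaf_edge y -> ~ (i = i /\ axis a i (iota y)).
Proof.
move=> yn [_ /axis_edge [g yE]]; apply: yn; exists g.
by apply: iota_inj; rewrite yE iota_edge.
Qed.

Lemma centre_off_axis i j (x : vertex_group GG None) :
  ~ (j = i /\ centre_edge i x) -> ~ (j = i /\ axis a i (iota x)).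
Proof.
move=> xn [ji /axis_edge [g xE]]; apply: xn; split=> //; exists g.
exact: iota_inj.
Qed.

(** A nontrivial element of K_0 moves the base vector by [rho_base]; an element
outside K_0 takes it to a translate of a chamber, where some form is negative. *)
Lemma faithful_action :
  exists act : pi1 GG -> V -> V,
    [/\ forall g v w, act g (v + w) = act g v + act g w,
        forall v, act 1%g v = v,
        forall g h v, act (g * h)%g v = act g (act h v)
      & forall g, (forall v, act g v = v) -> g = 1%g].
Proof.
have [||i g v|act [act1 actM act_in]] := @pi1_action m GG V gen_action.
- by move=> [i|] v /=; rewrite additive_morph1 // rho0 ?reflK.
- by move=> [i|] x y v /=; rewrite iotaM rhoD ?reflK.
- by rewrite /= iota_edge refl_axis //; apply/axis_edge; exists g.
have baseP : pos_cone S (base S) by move=> j t; rewrite phi_base.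
have act_reduced i h : reduced i h -> chamber S i (act h (base S)).
  elim=> {i h} [i y x yn|i y x j h yn xn hr hch].
    rewrite actM !act_in /=; apply: chamber_refl (leaf_off_axis yn).
    exact/pos_cone_refl/pos_cone_rho.
  rewrite !actM !act_in /=; apply: chamber_refl (leaf_off_axis yn).
  apply: chamber_refl hch _; exact: centre_off_axis.
exists act; split=> // [g v w|g gE].
  elim/pi1_ind: g v w => [v w|[i|] x g IHg v w]; rewrite ?act1 // !actM IHg !act_in /=.
    by rewrite refl_add rho_add refl_add.
  by rewrite rho_add.
have [[x gx]|[x [i [h [hr gx]]]]] := pi1_normal_form g.
  have := gE (base S); rewrite gx act_in /= => /rho_base x0.
  have -> : x = 1%g by apply: iota_inj; rewrite x0 (additive_morph1 (@iotaM _)).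
  exact: pi1_in1.
have [] := act_reduced i h hr; rewrite -[act h (base S)](rho0 S) -(addNr (iota x)) rhoD.
by have := gE (base S); rewrite gx actM act_in /= => ->; rewrite phi_base.
Qed.

End FaithfulAction.

(** * A reflection system of finite rank *)

Section DotProduct.
Variable D : nat.
Implicit Types s t : 'rV[int]_D.

Definition dot s t : int := \sum_j s 0 j * t 0 j.

Lemma dotC s t : dot s t = dot t s.
Proof. by apply: eq_bigr => j _; rewrite mulrC. Qed.

Lemma dotDr r s t : dot r (s + t) = dot r s + dot r t.
Proof. by rewrite -big_split; apply: eq_bigr => j _; rewrite mxE mulrDr. Qed.

Lemma dotDl r s t : dot (r + s) t = dot r t + dot s t.
Proof. by rewrite dotC dotDr !(dotC t). Qed.

Lemma dotZr (z : int) s t : dot s (z *: t) = z * dot s t.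
Proof. by rewrite mulr_sumr; apply: eq_bigr => j _; rewrite mxE mulrCA. Qed.

Lemma dot0l t : dot 0 t = 0.
Proof. by rewrite /dot big1 // => j _; rewrite mxE mul0r. Qed.

Lemma dot0r t : dot t 0 = 0. Proof. by rewrite dotC dot0l. Qed.

Lemma dot_gt0 t : t != 0 -> 0 < dot t t.
Proof.
move=> t0; rewrite lt_def sumr_ge0 ?andbT => [|j _]; last by rewrite -expr2 sqr_ge0.
apply: contra t0; rewrite psumr_eq0 => [/allP t0|j _]; last by rewrite -expr2 sqr_ge0.
apply/eqP/rowP => j; rewrite mxE; apply/eqP.
by have := t0 j (mem_index_enum j); rewrite mulf_eq0 orbb.
Qed.

End DotProduct.

Lemma Zp1_mulrz_eq0 (p : nat) (z : int) :
  ((Zp1 : 'I_p.+1) *~ z == 0) = (p.+1 %| z)%Z.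
Proof.
have nat_case n : ((Zp1 : 'I_p.+1) *+ n == 0) = (p.+1 %| n)%N.
  by rewrite Zp_mulrn -val_eqE /= modnMml mul1n.
by case: z => n; rewrite ?NegzE ?mulrNz ?oppr_eq0 nat_case.
Qed.

Section Block.
Variables (D p : nat).
Local Notation L := 'rV[int]_D.

Definition block : vectType int :=
  (int^o * L * int^o * {ffun 'I_p.+1 -> int^o})%type.

(** The components of e = (x, y, z, w). *)
Definition Bx (e : block) : int := e.1.1.1.
Definition By (e : block) : L := e.1.1.2.
Definition Bz (e : block) : int := e.1.2.
Definition Bw (e : block) : {ffun 'I_p.+1 -> int^o} := e.2.

Variables (mu : L -> L) (lam : L -> int).
Hypothesis muD : forall s t, mu (s + t) = mu s + mu t.
Hypothesis lamD : forall s t, lam (s + t) = lam s + lam t.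

Definition shift t : 'I_p.+1 := Zp1 *~ lam t.

(** On (x, y, z) the translation t acts by the unipotent matrix of the quadratic
form z |mu(t)|^2 + 2 <mu(t), y> + x, and on w by a cyclic shift of amount lam(t).
Both are trivial when mu(t) = 0 and P divides lam(t). *)
Definition tau t (e : block) : block :=
  (Bx e + 2 * dot (mu t) (By e) + dot (mu t) (mu t) * Bz e,
   By e + Bz e *: mu t, Bz e, [ffun k => Bw e (k + shift t)]).

Definition block_vec : block := (0, 0, 1, [ffun k => (k == 0)%:R]).

Definition xi (e : block) : int := 4 * (Bx e - Bw e 0).

Lemma block_ext e e' :
  Bx e = Bx e' -> By e = By e' -> Bz e = Bz e' -> Bw e =1 Bw e' -> e = e'.
Proof.
case: e e' => [[[x y] z] w] [[[x' y'] z'] w'].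
by rewrite /Bx /By /Bz /Bw /= => -> -> -> /ffunP ->.
Qed.

Lemma shiftD s t : shift (s + t) = shift s + shift t.
Proof. by rewrite /shift lamD mulrzDr. Qed.

Lemma tauD s t e : tau (s + t) e = tau s (tau t e).
Proof.
apply: block_ext => [|||k]; rewrite /tau /Bx /By /Bz /Bw /=.
- rewrite muD !dotDl !dotDr dotZr (dotC (mu t) (mu s)); ring.
- by rewrite muD scalerDr addrA addrAC.
- by [].
- by rewrite !ffunE shiftD addrA.
Qed.

Lemma tau_id t e : mu t = 0 -> shift t = 0 -> tau t e = e.
Proof.
move=> mt st; apply: block_ext => [|||k]; rewrite /tau /Bx /By /Bz /Bw /=.
- by rewrite mt !dot0l mulr0 mul0r !addr0.
- by rewrite mt scaler0 addr0.
- by [].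
- by rewrite ffunE st addr0.
Qed.

Lemma tau_add t e e' : tau t (e + e') = tau t e + tau t e'.
Proof.
apply: block_ext => [|||k]; rewrite /tau /Bx /By /Bz /Bw /=.
- rewrite dotDr; ring.
- by rewrite scalerDl addrACA.
- by [].
- by rewrite !ffunE.
Qed.

Lemma xi_add e e' : xi (e + e') = xi e + xi e'.
Proof. rewrite /xi /Bx /Bw /= !ffunE; ring. Qed.

Lemma xi_tau t :
  xi (tau t block_vec) = 4 * dot (mu t) (mu t) - 4 * (shift t == 0)%:R.
Proof.
rewrite /xi /tau /Bx /By /Bz /Bw /= !ffunE !add0r dot0r mulr0 add0r mulr1.
by rewrite mulrBr.
Qed.

End Block.

Section ReflectionRepresentation.
Variables (m D p : nat) (a : 'I_m -> 'rV[int]_D).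
Local Notation L := 'rV[int]_D.
Variables (mu : 'I_m -> L -> L) (lam : 'I_m -> L -> int).
Hypothesis muD : forall i s t, mu i (s + t) = mu i s + mu i t.
Hypothesis lamD : forall i s t, lam i (s + t) = lam i s + lam i t.
Hypothesis axisP : forall i t,
  axis a i t <-> mu i t = 0 /\ shift p (lam i) t = 0.

(** The first component c is fixed by L; being 2 on the roots and 1 on the base
vector, it contributes the constant terms of all the forms.  The next two carry
the unipotent representation (d, l) |-> (d, l + d t), which makes L act
faithfully on the base vector.  Then there is one block per edge. *)
Definition rspace : vectType int :=
  (int^o * int^o * L * {ffun 'I_m -> block D p})%type.

Definition model_rho t (v : rspace) : rspace :=
  (v.1.1.1, v.1.1.2, v.1.2 + v.1.1.2 *: t,
   [ffun i => tau (mu i) (lam i) t (v.2 i)]).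
Definition model_phi k (v : rspace) : int := v.1.1.1 + xi (v.2 k).
Definition model_root k : rspace :=
  (2, 0, 0, [ffun j => if j == k then block_vec D p else 0]).
Definition model_vec0 : rspace := (1, 1, 0, 0).

Lemma rspace_ext (v w : rspace) :
  v.1.1.1 = w.1.1.1 -> v.1.1.2 = w.1.1.2 -> v.1.2 = w.1.2 -> v.2 =1 w.2 -> v = w.
Proof.
case: v w => [[[c d] l] e] [[[c' d'] l'] e'] /=.
by move=> -> -> -> /ffunP ->.
Qed.

Lemma model_rho0 v : model_rho 0 v = v.
Proof.
apply: rspace_ext => [|||i] //=; first by rewrite scaler0 addr0.
have /axisP [m0 s0] : axis a i 0 by exists 0.
by rewrite ffunE tau_id.
Qed.

Lemma model_rhoD s t v : model_rho (s + t) v = model_rho s (model_rho t v).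
Proof.
apply: rspace_ext => [|||i] //=; first by rewrite scalerDr addrA addrAC.
by rewrite !ffunE tauD.
Qed.

Lemma model_rho_add t v w : model_rho t (v + w) = model_rho t v + model_rho t w.
Proof.
apply: rspace_ext => [|||i] //=; first by rewrite scalerDl addrACA.
by rewrite !ffunE tau_add.
Qed.

Lemma model_phi_add i v w : model_phi i (v + w) = model_phi i v + model_phi i w.
Proof. by rewrite /model_phi /= ffunE xi_add addrACA. Qed.

Lemma model_phi_axis i t v : axis a i t -> model_phi i (model_rho t v) = model_phi i v.
Proof. by move=> /axisP [mt st]; rewrite /model_phi /= ffunE tau_id. Qed.

Lemma tau0 i t : tau (mu i) (lam i) t (0 : block D p) = 0.
Proof. by apply: (addrI (tau (mu i) (lam i) t 0)); rewrite -tau_add !addr0. Qed.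

Lemma model_root_axis i t : axis a i t -> model_rho t (model_root i) = model_root i.
Proof.
move=> /axisP [mt st]; apply: rspace_ext => [|||j] //=; first by rewrite scale0r addr0.
by rewrite !ffunE; case: eqP => [->|_]; rewrite ?tau0 ?tau_id.
Qed.

Lemma xi0 : xi (0 : block D p) = 0.
Proof. by apply: (addrI (xi (0 : block D p))); rewrite -xi_add !addr0. Qed.

Lemma model_phi_root i j t : model_phi j (model_rho t (model_root i)) =
  if j == i
  then 2 + (4 * dot (mu i t) (mu i t) - 4 * (shift p (lam i) t == 0)%:R)
  else 2.
Proof.
rewrite /model_phi /= !ffunE; case: eqP => [->|_]; first by rewrite xi_tau.
by rewrite tau0 xi0 addr0.
Qed.

Lemma model_phi_root_self i : model_phi i (model_root i) = - 2.
Proof.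
have /axisP [m0 s0] : axis a i 0 by exists 0.
by rewrite -[model_root i]model_rho0 model_phi_root eqxx m0 s0 dot0l eqxx.
Qed.

Lemma model_phi_root_off i j t :
  ~ (j = i /\ axis a i t) -> 2 <= model_phi j (model_rho t (model_root i)).
Proof.
move=> off; rewrite model_phi_root; case: eqP => // ji.
have {}off : ~ axis a i t by move=> it; apply: off.
have [m0|/dot_gt0 m_gt0] := eqVneq (mu i t) 0; last by case: eqP => _ /=; lia.
rewrite m0 dot0l; case: eqP => s0 //.
by case: off; apply/axisP.
Qed.

Lemma model_phi_base j t : model_phi j (model_rho t model_vec0) = 1.
Proof. by rewrite /model_phi /= !ffunE tau0 xi0 addr0. Qed.

Lemma model_rho_base t : model_rho t model_vec0 = model_vec0 -> t = 0.
Proof. by move=> /(congr1 (fun v : rspace => v.1.2)) /=; rewrite scale1r add0r. Qed.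

Definition model_system : reflection_system rspace a :=
  ReflectionSystem model_rho0 model_rhoD model_rho_add model_phi_add
    model_phi_axis model_root_axis model_phi_root_self model_phi_root_off
    model_phi_base model_rho_base.

End ReflectionRepresentation.

(** With N_i = |a_i|^2, take P to be the product of all the N_i, and for lam_i
the form <a_i, t> rescaled by P / N_i, so that lam_i(a_i) = P for every i.  If
lam_i(t) = z P and P t = lam_i(t) a_i, then t = z a_i. *)
Lemma axis_forms (m D : nat) (a : 'I_m -> 'rV[int]_D) : (forall i, a i != 0) ->
  exists (p : nat) (mu : 'I_m -> 'rV[int]_D -> 'rV[int]_D)
         (lam : 'I_m -> 'rV[int]_D -> int),
  [/\ forall i s t, mu i (s + t) = mu i s + mu i t,
      forall i s t, lam i (s + t) = lam i s + lam i t
    & forall i t, axis a i t <-> mu i t = 0 /\ shift p (lam i) t = 0].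
Proof.
move=> a0; have dot_a i := dot_gt0 (a0 i).
pose P := \prod_i dot (a i) (a i).
have P_gt0 : 0 < P by apply: prodr_gt0.
pose q i := \prod_(j | j != i) dot (a j) (a j).
have qP i : q i * dot (a i) (a i) = P by rewrite /P (bigD1 i) //= mulrC.
have [p pP] : exists p : nat, P = p.+1 by case: (P) P_gt0 => [[|n]|] // _; exists n.
pose lam i t := q i * dot (a i) t.
pose mu i t := P *: t - lam i t *: a i.
have lamD i s t : lam i (s + t) = lam i s + lam i t by rewrite /lam dotDr mulrDr.
have lamZ i z t : lam i (z *: t) = z * lam i t by rewrite /lam dotZr mulrCA.
have shiftE i t : shift p (lam i) t = 0 <-> exists z, lam i t = z * P.
  rewrite pP; split=> [/eqP|[z lz]]; first by rewrite Zp1_mulrz_eq0 => /dvdzP.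
  by apply/eqP; rewrite Zp1_mulrz_eq0; apply/dvdzP; exists z.
exists p, mu, lam; split=> // [i s t|i t].
  by rewrite /mu lamD scalerDr scalerDl opprD addrACA.
split=> [[z ->]|[/eqP m0 /shiftE [z lz]]].
  split; last by apply/shiftE; exists z; rewrite -scaler_int intz lamZ [lam _ _]qP.
  by rewrite -scaler_int intz /mu lamZ [lam _ _]qP scalerA mulrC subrr.
exists z; rewrite -scaler_int intz.
move: m0; rewrite subr_eq0 lz mulrC -scalerA => /eqP/rowP tz.
apply/rowP => j; have := tz j; rewrite !mxE.
by apply: mulfI; rewrite gt_eqF.
Qed.

(** * The common lattice of the vertex groups *)

Section CommonLattice.
Variables (m : nat) (GG : star_graph_of_groups m).
Local Notation K := (vertex_group GG).
Hypothesis centre_free : free_abelian_fin_rank (K None).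
Variable k : forall i : 'I_m, edge_group GG i.
Hypothesis k_gen : forall i : 'I_m, is_generator (k i).
Hypothesis k_prim : forall i : 'I_m, is_primitive (omega GG i (k i)).

(** Mapping w_i to a_i = iota(alpha_i) keeps iota_i injective because a_i is
nonzero and the remaining coordinates of K_i are independent of those of K_0. *)
Lemma common_lattice :
  exists (D : nat) (iota : forall v, K v -> 'rV[int]_D),
    [/\ forall v (x y : K v), iota v (x * y)%g = iota v x + iota v y,
        forall v, injective (iota v),
        forall i g, iota None (alpha GG i g) = iota (Some i) (omega GG i g)
      & forall i, iota None (alpha GG i (k i)) != 0].
Proof.
have [n0 [c [cM c_inj]]] := free_abelian_coords centre_free.
have [n nP] := choice (fun i => primitive_coords (k_prim i)).
pose d := \max_i n i.
have {}nP i := nP i d (leq_bigmax i).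
pose e i := sval (cid (nP i)); pose f i := sval (cid (svalP (cid (nP i)))).
have efP i : [/\ forall x y, e i (x * y)%g = e i x + e i y,
        forall x y, f i (x * y)%g = f i x + f i y,
        forall x y, e i x = e i y -> f i x = f i y -> x = y,
        e i (omega GG i (k i)) = 1 & f i (omega GG i (k i)) = 0].
  exact: svalP (cid (svalP (cid (nP i)))).
pose iota v : K v -> 'rV[int]_(n0 + d) :=
  match v with
  | None => fun x => row_mx (c x) 0
  | Some i => fun y => row_mx (e i y *: c (alpha GG i (k i))) (f i y)
  end.
have ck0 i : c (alpha GG i (k i)) != 0.
  have [eM _ _ ek _] := efP i; apply/eqP => c_k.
  have k1 : k i = 1%g.
    apply: (alpha_inj (s := GG)); apply: c_inj.
    by rewrite c_k multiplicative1 (additive_morph1 cM).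
  by move: ek; rewrite k1 multiplicative1 (additive_morph1 eM).
have iotaM v (x y : K v) : iota v (x * y)%g = iota v x + iota v y.
  case: v x y => [i|] x y; rewrite /= add_row_mx ?addr0 ?cM //.
  by have [eM fM _ _ _] := efP i; rewrite eM fM scalerDl.
exists (n0 + d)%N, iota; split=> // [[i|] x y /=|i g|i].
- have [_ _ ef_inj _ _] := efP i; case/eq_row_mx => /rowP exy; apply: ef_inj.
  have /rV0Pn [j cj] := ck0 i.
  by apply: (mulIf cj); have := exy j; rewrite !mxE.
- by case/eq_row_mx => /c_inj.
- have [z ->] := k_gen g.
  have agree : iota None (alpha GG i (k i)) = iota (Some i) (omega GG i (k i)).
    by have [_ _ _ ek fk] := efP i; rewrite /= ek fk scale1r.
  rewrite (@additive_expgz _ _ (fun h => iota None (alpha GG i h))); last first.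
    by move=> x y; rewrite gmulfM iotaM.
  rewrite (@additive_expgz _ _ (fun h => iota (Some i) (omega GG i h))); last first.
    by move=> x y; rewrite gmulfM iotaM.
  by rewrite agree.
- by rewrite -row_mx0; apply: contra (ck0 i) => /eqP/eq_row_mx [-> _].
Qed.

End CommonLattice.

Theorem theorem4p3 (m : nat) (GG : star_graph_of_groups m)
    (hV : forall v : option 'I_m, free_abelian_fin_rank (vertex_group GG v))
    (k : forall i : 'I_m, edge_group GG i)
    (hk : forall i : 'I_m, is_generator (k i))
    (hprim : forall i : 'I_m, is_primitive (omega GG i (k i))) :
  Z_linear (pi1 GG).
Proof.
have [D [iota [iotaM iota_inj iota_edge k_neq0]]] :=
  common_lattice (hV None) hk hprim.
pose a i := iota None (alpha GG i (k i)).
have [p [mu [lam [muD lamD axisP]]]] := axis_forms k_neq0.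
have axis_edge i t : axis a i t <-> exists g, t = iota None (alpha GG i g).
  have powE z : iota None (alpha GG i (expgz (k i) z)) = a i *~ z.
    by apply: (additive_expgz (h := fun h => iota None (alpha GG i h))) => x y;
       rewrite gmulfM iotaM.
  split=> [[z ->]|[g ->]]; first by exists (expgz (k i) z).
  by have [z ->] := hk i g; exists z.
have [act [actD act1 actM act_faithful]] :=
  faithful_action (model_system muD lamD axisP)
    iotaM iota_inj iota_edge axis_edge.
exact: Z_linear_of_action actD act1 actM act_faithful.
Qed.
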